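(* Let $m>0$, $0<k\leq 1$ and $0\leq\lambda<1$. Then the function $$\mathcal{G}(m,z)=\int_{0}^{z}\frac{\mathcal{F}(m,t)}{t}\,dt,\qquad\text{where } \mathcal{F}(m,z)=z-\sum_{n=2}^{\infty}\frac{m^{n-1}}{(n-1)!}e^{-m}z^{n},$$ is in $\mathcal{S}(k,\lambda)$ if and only if $$\big((1-\lambda)+k(1+\lambda)\big)(1-e^{-m})+\frac{(1-\lambda)(k-1)}{m}\big(1-e^{-m}-me^{-m}\big)\leq 2k.$$
   Context: Let $\mathcal{U}=\{z\in\mathbb{C}:|z|<1\}$. Let $\mathcal{A}$ be the class of functions $f(z)=z+\sum_{n=2}^{\infty}a_nz^n$ analytic in $\mathcal{U}$, and let $\mathcal{T}$ be the subclass of $\mathcal{A}$ of functions of the form $f(z)=z-\sum_{n=2}^{\infty}|a_n|z^n$, $z\in\mathcal{U}$. For $0<k\leq1$ and $0\leq\lambda<1$, a function $f$ of the form $f(z)=z-\sum_{n=2}^{\infty}|a_n|z^n$ (i.e. $f\in\mathcal{T}$) is in $\mathcal{S}(k,\lambda)$ if $$\left|\frac{\frac{zf'(z)}{(1-\lambda)f(z)+\lambda zf'(z)}-1}{\frac{zf'(z)}{(1-\lambda)f(z)+\lambda zf'(z)}+1}\right|<k\qquad (z\in\mathcal{U}).$$ *)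

(* Defs.v *)
From Stdlib Require Export Reals Factorial.
From Coquelicot Require Export Coquelicot.

Open Scope R_scope.

Definition unit_disc (z : C) : Prop := Cmod z < 1.

(* The terms of a sum over n >= 2, reindexed from 0 (n = j + 2). *)
Definition tail2 (u : nat -> C) : nat -> C := fun j => u (j + 2)%nat.

Definition is_Cseries (u : nat -> C) (s : C) : Prop :=
  @is_series C_AbsRing C_NormedModule u s.

(* The sum of a convergent complex series (unspecified if it diverges);
   same pattern as Coquelicot's [RInt] from [is_RInt]. *)
Definition Cseries (u : nat -> C) : C :=
  @iota C_CompleteNormedModule (is_Cseries u).

(* Holomorphy on the disc; differentiability is over the field C. *)
Definition analytic_in_disc (f : C -> C) : Prop :=
  forall z : C, unit_disc z -> @ex_derive C_AbsRing C_NormedModule f z.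

Definition class_A (f : C -> C) : Prop :=
  analytic_in_disc f /\
  exists a : nat -> C, forall z : C, unit_disc z ->
    exists s : C,
      is_Cseries (tail2 (fun n => a n * z ^ n)%C) s /\ f z = (z + s)%C.

Definition class_T (f : C -> C) : Prop :=
  class_A f /\
  exists a : nat -> C, forall z : C, unit_disc z ->
    exists s : C,
      is_Cseries (tail2 (fun n => RtoC (Cmod (a n)) * z ^ n)%C) s /\
      f z = (z - s)%C.

Definition S_denom (lam : R) (f : C -> C) (z : C) : C :=
  (RtoC (1 - lam) * f z + RtoC lam * (z * C_derive f z))%C.

Definition S_quot (lam : R) (f : C -> C) (z : C) : C :=
  (z * C_derive f z / S_denom lam f z)%C.

(* At z = 0 the quotient has the form 0/0: its singularity there is removable,
   with value 1, so that the inequality at 0 reads 0 < k.  Elsewhere both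
   denominators are required not to vanish, since division by 0 is total. *)
Definition class_S (k lam : R) (f : C -> C) : Prop :=
  class_T f /\
  forall z : C, unit_disc z -> z <> RtoC 0 ->
    S_denom lam f z <> RtoC 0 /\
    (S_quot lam f z + 1)%C <> RtoC 0 /\
    Cmod ((S_quot lam f z - 1) / (S_quot lam f z + 1))%C < k.

(* The integral of g along the straight segment from 0 to z. *)
Definition Cint0 (g : C -> C) (z : C) : C :=
  @RInt C_R_CompleteNormedModule (fun s : R => g (RtoC s * z) * z)%C 0 1.

Definition poisson_coef (m : R) (n : nat) : R :=
  m ^ (n - 1) / INR (fact (n - 1)) * exp (- m).

Definition poisson_F (m : R) (z : C) : C :=
  (z - Cseries (tail2 (fun n => RtoC (poisson_coef m n) * z ^ n)))%C.

(* The integrand takes a junk value at t = 0 only, where it has the removable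
   value 1; this does not affect the integral. *)
Definition poisson_G (m : R) (z : C) : C :=
  Cint0 (fun t => poisson_F m t / t)%C z.

(* Main.v *)
Require Import Defs.
From Stdlib Require Import Reals Lra Lia.
From Coquelicot Require Import Coquelicot.

(* Write F = z - P with P = sum p_n z^n.  Termwise integration gives
   G = z - Q with Q = sum (p_n / n) z^n, and z G' = F, so that the quotient in
   the definition of S(k, lambda) is
     - (1 - lambda) (P - Q) / (2 z - (1 - lambda) Q - (1 + lambda) P).
   All coefficients being nonnegative with sum p_n <= 1, the triangle
   inequality on |z| = r < 1 shows that no denominator vanishes and that the
   coefficient inequality suffices.  Conversely, at z = r real both sides are
   real, and r -> 1 gives the coefficient inequality, the error being
   controlled by 1 - r^n <= n (1 - r). *)

(** * Derivatives from quadratic error bounds; comparison of series *)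

(** Complex differentiability in the disc and real differentiability along a ray are both read off
    from one quadratic bound, hence the general [K] and [V]. *)
Lemma is_derive_of_quadratic_error {K : AbsRing} {V : NormedModule K}
    (f : K -> V) (x : K) (l : V) (d M : R) :
  0 < d -> 0 <= M ->
  (forall y : K, norm (minus y x) < d ->
     norm (minus (minus (f y) (f x)) (scal (minus y x) l))
       <= M * norm (minus y x) ^ 2) ->
  is_derive f x l.
Proof.
intros Hd HM H; split; [apply is_linear_scal_l|].
intros x' Hx' eps.
rewrite <- (is_filter_lim_locally_unique _ _ Hx'); clear x' Hx'.
(* With [t] the norm of the increment, [t < eps / (M + 1)] gives [M * t ^ 2 <= eps * t]; the [+ 1]
   covers [M = 0]. *)
assert (Hr : 0 < Rmin d (eps / (M + 1))).
{ apply Rmin_pos; [exact Hd|].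
  apply Rdiv_lt_0_compat; [apply cond_pos|lra]. }
apply (locally_le_locally_norm x).
exists (mkposreal _ Hr); intros y Hy; unfold ball_norm in Hy; simpl in Hy.
assert (H1 := H y (Rlt_le_trans _ _ _ Hy (Rmin_l _ _))).
assert (H2 := Rlt_le_trans _ _ _ Hy (Rmin_r _ _)).
apply (Rle_trans _ _ _ H1).
revert H2; generalize (norm_ge_0 (minus y x)).
change (norm (V := AbsRing_NormedModule K) (minus y x)) with (norm (minus y x)).
generalize (norm (minus y x)); intros t Ht0 Ht.
assert (H3 : t * (M + 1) < eps / (M + 1) * (M + 1))
  by (apply Rmult_lt_compat_r; lra).
replace (eps / (M + 1) * (M + 1)) with (pos eps) in H3 by (field; lra).
nra.
Qed.

Lemma is_series_norm_le {K : AbsRing} {V : NormedModule K}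
    (a : nat -> V) (b : nat -> R) (s : V) (l : R) :
  (forall j, norm (a j) <= b j) -> is_series a s -> is_series b l ->
  norm s <= l.
Proof.
intros Hab Ha Hb.
refine (filterlim_le (F := eventually) (fun n => norm (sum_n a n)) (sum_n b)
          (Finite (norm s)) (Finite l) _ _ Hb).
- exists 0%nat; intros n _.
  apply Rle_trans with (1 := norm_sum_n_m a 0 n).
  apply sum_n_m_le; exact Hab.
- apply (filterlim_comp _ _ _ _ _ _ _ _ Ha (filterlim_norm s)).
Qed.

Lemma is_series_le (a b : nat -> R) (s l : R) :
  (forall j, a j <= b j) -> is_series a s -> is_series b l -> s <= l.
Proof.
intros Hab Ha Hb.
refine (filterlim_le (F := eventually) (sum_n a) (sum_n b)
          (Finite s) (Finite l) _ Ha Hb).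
exists 0%nat; intros n _; apply sum_n_m_le; exact Hab.
Qed.

Lemma is_series_ge0 (a : nat -> R) (l : R) :
  (forall j, 0 <= a j) -> is_series a l -> 0 <= l.
Proof.
intros Ha H; apply Rle_trans with (Rabs l); [apply Rabs_pos|].
apply (@is_series_norm_le R_AbsRing R_NormedModule a a l l); [|exact H|exact H].
intros j; apply Req_le, Rabs_pos_eq, Ha.
Qed.

Lemma is_Cseries_unique (u : nat -> C) (s : C) :
  is_Cseries u s -> Cseries u = s.
Proof.
intros H.
exact (@iota_filterlim_locally C_AbsRing C_CompleteNormedModule nat eventually _ _ s H).
Qed.

Lemma is_Cseries_RtoC (a : nat -> R) (l : R) :
  is_series a l -> is_Cseries (fun j => RtoC (a j)) (RtoC l).
Proof.
intros H.
assert (HR : filterlim RtoC (locally l) (@locally C_UniformSpace (RtoC l))).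
{ intros P [eps HP]; exists eps; intros y Hy; apply HP.
  split; [exact Hy|apply ball_center]. }
apply (filterlim_ext (fun n => RtoC (sum_n a n))).
- intros n; induction n as [|n IH].
  + now rewrite !sum_O.
  + rewrite !sum_Sn, <- IH. apply RtoC_plus.
- exact (filterlim_comp _ _ _ _ _ _ _ _ H HR).
Qed.

(* [ring] and [field] need the type of the equation to be [C] or [R] itself,
   not the carrier of a Coquelicot structure. *)
Ltac eq_at T := match goal with |- ?a = ?b => change (@eq T a b) end.

(** * Power series with nonnegative summable coefficients on the closed disc *)

(** The exponent map [e] is free, so that a series with exponents [j + 2] and its derivatives, with
    exponents lowered by [pred], fall under the same lemmas. *)
Definition psum (e : nat -> nat) (u : nat -> R) (z : C) : C :=
  Cseries (fun j => RtoC (u j) * z ^ e j)%C.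

Lemma Cmod_pow_le_1 (z : C) (n : nat) : Cmod z <= 1 -> Cmod (z ^ n)%C <= 1.
Proof.
intros Hz; rewrite Cmod_pow; rewrite <- (pow1 n).
apply pow_incr; split; [apply Cmod_ge_0|exact Hz].
Qed.

Lemma Cmod_term_le (u : R) (z : C) (n : nat) :
  0 <= u -> Cmod z <= 1 -> Cmod (RtoC u * z ^ n)%C <= u.
Proof.
intros Hu Hz; rewrite Cmod_mult, Cmod_R, Rabs_pos_eq by exact Hu.
assert (H := Cmod_pow_le_1 z n Hz); nra.
Qed.

(** The coefficients dominate the terms as soon as [Cmod z <= 1], so convergence includes the
    boundary circle. *)
Lemma psum_correct (e : nat -> nat) (u : nat -> R) (z : C) :
  (forall j, 0 <= u j) -> ex_series u -> Cmod z <= 1 ->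
  is_Cseries (fun j => RtoC (u j) * z ^ e j)%C (psum e u z).
Proof.
intros Hu Hs Hz.
destruct (@ex_series_le C_AbsRing C_CompleteNormedModule
  (fun j => RtoC (u j) * z ^ e j)%C u) as [s H].
- intros j; apply Cmod_term_le; auto.
- exact Hs.
- unfold psum; now rewrite (is_Cseries_unique _ s H).
Qed.

Lemma psum_ext (e e' : nat -> nat) (u u' : nat -> R) (z : C) :
  (forall j, e j = e' j) -> (forall j, u j = u' j) -> (forall j, 0 <= u j) ->
  ex_series u -> Cmod z <= 1 -> psum e u z = psum e' u' z.
Proof.
intros He Hu H0 Hs Hz; symmetry; apply is_Cseries_unique.
apply (is_series_ext (fun j => RtoC (u j) * z ^ e j)%C).
- intros j; now rewrite He, Hu.
- now apply psum_correct.
Qed.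

Lemma psum_succ (e : nat -> nat) (u : nat -> R) (z : C) :
  (forall j, 0 <= u j) -> ex_series u -> Cmod z <= 1 ->
  psum (fun j => S (e j)) u z = (z * psum e u z)%C.
Proof.
intros H0 Hs Hz; apply is_Cseries_unique.
apply (is_series_ext (fun j => z * (RtoC (u j) * z ^ e j))%C).
- intros j; eq_at C; rewrite Cpow_S; ring.
- apply (@is_series_scal C_AbsRing C_NormedModule z). now apply psum_correct.
Qed.

(** Every term contains the factor [z ^ N]. With [N = 2] this is the source of all the factors
    [r ^ 2] in the criterion. *)
Lemma Cmod_psum_le (e : nat -> nat) (u : nat -> R) (N : nat) (l : R) (z : C) :
  (forall j, (N <= e j)%nat) -> (forall j, 0 <= u j) -> is_series u l ->
  Cmod z <= 1 -> Cmod (psum e u z) <= Cmod z ^ N * l.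
Proof.
intros He H0 Hs Hz.
apply (@is_series_norm_le C_AbsRing C_NormedModule
  (fun j => RtoC (u j) * z ^ e j)%C (fun j => Cmod z ^ N * u j)).
- intros j; change (Cmod (RtoC (u j) * z ^ e j) <= Cmod z ^ N * u j).
  replace (e j) with (N + (e j - N))%nat by (specialize (He j); lia).
  rewrite Cpow_add_r.
  replace (RtoC (u j) * (z ^ N * z ^ (e j - N)))%C
    with (z ^ N * (RtoC (u j) * z ^ (e j - N)))%C by ring.
  rewrite Cmod_mult, Cmod_pow.
  apply Rmult_le_compat_l; [apply pow_le, Cmod_ge_0|].
  now apply Cmod_term_le.
- apply psum_correct; auto; now exists l.
- now apply (is_series_scal_l (V := R_NormedModule) (Cmod z ^ N) u).
Qed.

Lemma psum_RtoC (e : nat -> nat) (u : nat -> R) (r v : R) :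
  is_series (fun j => u j * r ^ e j) v -> psum e u (RtoC r) = RtoC v.
Proof.
intros H; apply is_Cseries_unique.
apply (is_series_ext (fun j => RtoC (u j * r ^ e j))).
- intros j; now rewrite RtoC_mult, RtoC_pow.
- now apply is_Cseries_RtoC.
Qed.

(** Writing E_n for the error, E_(n+1) = w E_n + n z^(n-1) (w - z)^2, so the constant grows by at
    most n at each step, and n^2 + n <= (n+1)^2. *)
Lemma Cmod_pow_taylor (n : nat) (w z : C) :
  Cmod w <= 1 -> Cmod z <= 1 ->
  Cmod (w ^ n - z ^ n - (w - z) * (RtoC (INR n) * z ^ pred n))%C
    <= INR n ^ 2 * Cmod (w - z) ^ 2.
Proof.
intros Hw Hz; induction n as [|n IH].
- simpl. replace (1 - 1 - (w - z) * (0 * 1))%C with (RtoC 0) by ring.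
  rewrite Cmod_0; lra.
- replace (w ^ S n - z ^ S n - (w - z) * (RtoC (INR (S n)) * z ^ pred (S n)))%C
    with (w * (w ^ n - z ^ n - (w - z) * (RtoC (INR n) * z ^ pred n))
          + RtoC (INR n) * z ^ pred n * ((w - z) * (w - z)))%C.
  + eapply Rle_trans; [apply Cmod_triangle|].
    assert (H2 : Cmod (RtoC (INR n) * z ^ pred n) <= INR n)
      by (apply Cmod_term_le; [apply pos_INR|exact Hz]).
    rewrite Cmod_mult, (Cmod_mult (RtoC _ * _)%C), (Cmod_mult (w - z)%C).
    rewrite S_INR. assert (Hn := pos_INR n).
    set (x := Cmod (_ - (w - z) * _)%C) in *.
    assert (Hx : 0 <= x) by apply Cmod_ge_0.
    assert (Hd := Cmod_ge_0 (w - z)). set (d := Cmod (w - z)) in *.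
    assert (H3 : Cmod w * x <= x) by nra.
    assert (Hdd : 0 <= d * d) by nra.
    assert (H4 : Cmod (RtoC (INR n) * z ^ pred n) * (d * d) <= INR n * (d * d))
      by (apply Rmult_le_compat_r; assumption).
    nra.
  + rewrite S_INR, RtoC_plus; destruct n as [|n]; simpl pred.
    * simpl; ring.
    * rewrite !Cpow_S; ring.
Qed.

(** The error bounds for the powers are summed with weights [u j]; the constant is therefore the
    second moment of the exponents. *)
Lemma psum_taylor (e : nat -> nat) (u : nat -> R) (K : R) (w z : C) :
  (forall j, 0 <= u j) -> ex_series u -> ex_series (fun j => INR (e j) * u j) ->
  is_series (fun j => INR (e j) ^ 2 * u j) K ->
  Cmod w <= 1 -> Cmod z <= 1 ->
  Cmod (psum e u w - psum e u z
        - (w - z) * psum (fun j => pred (e j)) (fun j => INR (e j) * u j)%R z)%C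
    <= K * Cmod (w - z) ^ 2.
Proof.
intros H0 H1 H2 H3 Hw Hz.
apply (@is_series_norm_le C_AbsRing C_NormedModule
  (fun j => RtoC (u j) * w ^ e j - RtoC (u j) * z ^ e j
        - (w - z) * (RtoC (INR (e j) * u j)%R * z ^ pred (e j)))%C
  (fun j => (INR (e j) ^ 2 * u j) * Cmod (w - z) ^ 2)).
- intros j; change norm with Cmod.
  rewrite RtoC_mult.
  replace (RtoC (u j) * w ^ e j - RtoC (u j) * z ^ e j
        - (w - z) * (RtoC (INR (e j)) * RtoC (u j) * z ^ pred (e j)))%C
  with (RtoC (u j) *
     (w ^ e j - z ^ e j - (w - z) * (RtoC (INR (e j)) * z ^ pred (e j))))%C by ring.
  rewrite Cmod_mult, Cmod_R, Rabs_pos_eq by auto.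
  replace (INR (e j) ^ 2 * u j * Cmod (w - z) ^ 2) with
    (u j * (INR (e j) ^ 2 * Cmod (w - z) ^ 2)) by ring.
  apply Rmult_le_compat_l; [auto|now apply Cmod_pow_taylor].
- assert (H4 : forall j, 0 <= INR (e j) * u j)
    by (intros j; apply Rmult_le_pos; [apply pos_INR|auto]).
  apply (@is_series_minus C_AbsRing C_NormedModule).
  + apply (@is_series_minus C_AbsRing C_NormedModule); now apply psum_correct.
  + apply (@is_series_scal C_AbsRing C_NormedModule (w - z)%C).
    now apply (psum_correct (fun j => pred (e j)) (fun j => INR (e j) * u j)).
- now apply is_series_scal_r.
Qed.

(** * Differentiability in the disc and along rays *)

Lemma is_derive_in_disc (f : C -> C) (g : C) (K : R) (z : C) :
  0 <= K -> Cmod z < 1 ->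
  (forall w, Cmod w <= 1 ->
     Cmod (f w - f z - (w - z) * g)%C <= K * Cmod (w - z) ^ 2) ->
  @is_derive C_AbsRing C_NormedModule f z g.
Proof.
intros HK Hz H.
apply (@is_derive_of_quadratic_error C_AbsRing C_NormedModule f z g (1 - Cmod z) K);
  [lra|exact HK|].
intros w Hw; change (Cmod (w - z) < 1 - Cmod z) in Hw.
change (Cmod (f w - f z - (w - z) * g)%C <= K * Cmod (w - z) ^ 2).
apply H.
replace w with (w - z + z)%C by ring.
eapply Rle_trans; [apply Cmod_triangle|lra].
Qed.

(** The derivative is two-sided even at [s = 0] and [s = 1], as the fundamental theorem of calculus
    on [0, 1] will require. *)
Lemma is_derive_along_ray (f : C -> C) (g : C) (K s : R) (z : C) :
  0 <= K -> 0 <= s <= 1 -> Cmod z < 1 ->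
  (forall w, Cmod w <= 1 ->
     Cmod (f w - f (RtoC s * z) - (w - RtoC s * z) * g)%C
       <= K * Cmod (w - RtoC s * z) ^ 2) ->
  @is_derive R_AbsRing C_R_NormedModule (fun t => f (RtoC t * z)%C) s (z * g)%C.
Proof.
intros HK Hs Hz H.
apply (@is_derive_of_quadratic_error R_AbsRing C_R_NormedModule
         (fun t => f (RtoC t * z)%C) s (z * g)%C (1 - Cmod z) K);
  [lra|exact HK|].
intros t Ht; change (Rabs (t - s) < 1 - Cmod z) in Ht.
assert (Hz0 := Cmod_ge_0 z).
(* The radius [1 - Cmod z] gives |t| <= 2 - |z|, and (2 - |z|) |z| = 1 - (1 - |z|)^2 <= 1. *)
assert (H1 : Cmod (RtoC t * z) <= 1).
{ rewrite Cmod_mult, Cmod_R.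
  assert (Rabs t <= 2 - Cmod z)
    by (revert Ht; unfold Rabs; destruct (Rcase_abs t), (Rcase_abs (t - s)); lra).
  nra. }
specialize (H _ H1).
change (norm (minus t s)) with (Rabs (t - s)).
rewrite <- Cmod_norm.
replace (RtoC t * z - RtoC s * z)%C with (RtoC (t - s) * z)%C in H
  by (rewrite RtoC_minus; ring).
eapply Rle_trans; [|eapply Rle_trans; [exact H|]].
- apply Req_le; f_equal.
  apply injective_projections; simpl; unfold minus, plus, opp, scal, mult; simpl;
  unfold mult; simpl; ring.
- rewrite Cmod_mult, Cmod_R, Rpow_mult_distr.
  apply Rmult_le_compat_l; [exact HK|].
  assert (0 <= Rabs (t - s) ^ 2) by apply pow2_ge_0.
  assert (Cmod z ^ 2 <= 1) by nra.
  nra.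
Qed.

Lemma id_minus_psum_taylor (e : nat -> nat) (u : nat -> R) (K : R) (w z : C) :
  (forall j, 0 <= u j) -> ex_series u -> ex_series (fun j => INR (e j) * u j) ->
  is_series (fun j => INR (e j) ^ 2 * u j) K ->
  Cmod w <= 1 -> Cmod z <= 1 ->
  Cmod ((w - psum e u w) - (z - psum e u z)
        - (w - z) * (1 - psum (fun j => pred (e j)) (fun j => INR (e j) * u j)%R z))%C
    <= K * Cmod (w - z) ^ 2.
Proof.
intros H0 H1 H2 H3 Hw Hz.
eapply Rle_trans; [|apply (psum_taylor e u K w z); assumption].
apply Req_le; rewrite <- Cmod_opp; f_equal; ring.
Qed.

(** * The Alexander transform of z - sum p_n z^n *)

Section AlexanderTransform.

(* [p j] is the coefficient of index n = j + 2. *)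
Variable p : nat -> R.
Hypothesis p_ge0 : forall j, 0 <= p j.
Hypothesis ex_p2 : ex_series (fun j => INR (j + 2) ^ 2 * p j).

(** The second moment of [p] serves as the common majorant for the moments of order 0, 1 and 2 that
    occur below. *)
Lemma ex_series_dominated (v : nat -> R) :
  (forall j, 0 <= v j <= INR (j + 2) ^ 2 * p j) -> ex_series v.
Proof.
intros H; apply (@ex_series_le R_AbsRing R_CompleteNormedModule v) with (2 := ex_p2).
intros j; change (Rabs (v j) <= INR (j + 2) ^ 2 * p j).
rewrite Rabs_pos_eq; apply H.
Qed.

Lemma INR_add2_ge (j : nat) : 2 <= INR (j + 2).
Proof. rewrite plus_INR; assert (H := pos_INR j); simpl; lra. Qed.

Lemma ex_p : ex_series p.
Proof.
apply ex_series_dominated; intros j; split; [auto|].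
assert (H := INR_add2_ge j); specialize (p_ge0 j).
assert (1 <= INR (j + 2) ^ 2) by nra. nra.
Qed.

Lemma ex_p1 : ex_series (fun j => INR (j + 2) * p j).
Proof.
apply ex_series_dominated; intros j.
assert (H := INR_add2_ge j); specialize (p_ge0 j).
split; [nra|]. assert (INR (j + 2) <= INR (j + 2) ^ 2) by nra. nra.
Qed.

Definition alexander_coef (j : nat) : R := p j / INR (j + 2).

Lemma index_mul_alexander_coef (j : nat) : INR (j + 2) * alexander_coef j = p j.
Proof. unfold alexander_coef; field; assert (H := INR_add2_ge j); lra. Qed.

Lemma alexander_coef_bounds (j : nat) : 0 <= alexander_coef j <= p j.
Proof.
assert (H := INR_add2_ge j); assert (H1 := index_mul_alexander_coef j); specialize (p_ge0 j).
split; nra.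
Qed.

Lemma ex_alexander_coef : ex_series alexander_coef.
Proof.
apply (@ex_series_le R_AbsRing R_CompleteNormedModule alexander_coef) with (2 := ex_p).
intros j; change (Rabs (alexander_coef j) <= p j).
rewrite Rabs_pos_eq; apply alexander_coef_bounds.
Qed.

(** For general coefficients, [neg_series], [alexander] and [alexander_deriv] are F, G and G'; the
    exponent n - 1 in G' is [j + 1]. *)
Definition neg_series (z : C) : C := (z - psum (fun j => j + 2)%nat p z)%C.
Definition alexander (z : C) : C := (z - psum (fun j => j + 2)%nat alexander_coef z)%C.

Definition alexander_deriv (z : C) : C := (1 - psum (fun j => j + 1)%nat p z)%C.

Lemma mul_alexander_deriv (z : C) : Cmod z <= 1 -> (z * alexander_deriv z)%C = neg_series z.
Proof.
intros Hz; unfold alexander_deriv, neg_series.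
rewrite (psum_ext (fun j => j + 2)%nat (fun j => S (j + 1)) p p)
  by (first [exact ex_p | auto]; intros; lia).
rewrite psum_succ by (auto; exact ex_p). ring.
Qed.

Lemma alexander_taylor : exists K, 0 <= K /\ forall w z, Cmod w <= 1 -> Cmod z <= 1 ->
  Cmod (alexander w - alexander z - (w - z) * alexander_deriv z)%C <= K * Cmod (w - z) ^ 2.
Proof.
assert (Hq : ex_series (fun j => INR (j + 2) * alexander_coef j)).
{ apply (ex_series_ext p); [intros j; now rewrite index_mul_alexander_coef|exact ex_p]. }
(* Since n^2 (p_n / n) = n p_n, the Taylor constant of G is only the first moment of [p]. *)
destruct ex_p1 as [K HK].
exists K; split.
{ apply (is_series_ge0 _ _) with (2 := HK).
  intros j; specialize (p_ge0 j); assert (H := INR_add2_ge j); nra. }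
intros w z Hw Hz; unfold alexander, alexander_deriv.
rewrite (psum_ext (fun j => j + 1)%nat (fun j => pred (j + 2)) p
          (fun j => INR (j + 2) * alexander_coef j)).
- apply id_minus_psum_taylor; auto.
  + intros j; apply alexander_coef_bounds.
  + apply ex_alexander_coef.
  + apply (is_series_ext (fun j => INR (j + 2) * p j)); [|exact HK].
    intros j; rewrite <- (index_mul_alexander_coef j) at 1; simpl; ring.
- intros j; lia.
- intros j; now rewrite index_mul_alexander_coef.
- auto.
- exact ex_p.
- exact Hz.
Qed.

Lemma is_derive_alexander (z : C) : Cmod z < 1 ->
  @is_derive C_AbsRing C_NormedModule alexander z (alexander_deriv z).
Proof.
destruct alexander_taylor as [K [HK H]]; intros Hz.
apply (is_derive_in_disc alexander (alexander_deriv z) K); auto.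
intros w Hw; apply H; lra.
Qed.

(** Continuity is obtained from differentiability along the ray. The coefficients of G' are not
    divided by n, so here the second moment is used. *)
Lemma continuous_alexander_deriv_ray (z : C) (s : R) : Cmod z < 1 -> 0 <= s <= 1 ->
  @continuous R_UniformSpace C_R_NormedModule (fun t => alexander_deriv (RtoC t * z))%C s.
Proof.
intros Hz Hs.
assert (Hsz : Cmod (RtoC s * z) <= 1).
{ rewrite Cmod_mult, Cmod_R, Rabs_pos_eq by lra. assert (H := Cmod_ge_0 z); nra. }
assert (Hj : forall j, INR (j + 1) <= INR (j + 2)) by (intros j; apply le_INR; lia).
assert (Hj0 : forall j, 0 <= INR (j + 1)) by (intros j; apply pos_INR).
assert (E1 : ex_series (fun j => INR (j + 1) * p j)).
{ apply ex_series_dominated; intros j; specialize (p_ge0 j); specialize (Hj j).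
  specialize (Hj0 j). split; [nra|].
  assert (INR (j + 1) <= INR (j + 2) ^ 2) by (assert (H2 := INR_add2_ge j); nra).
  nra. }
assert (E2 : ex_series (fun j => INR (j + 1) ^ 2 * p j)).
{ apply ex_series_dominated; intros j; specialize (p_ge0 j); specialize (Hj j).
  specialize (Hj0 j). split; [nra|].
  assert (INR (j + 1) ^ 2 <= INR (j + 2) ^ 2) by nra.
  nra. }
destruct E2 as [K HK].
apply (continuous_minus (U := R_UniformSpace) (V := C_R_NormedModule) (fun _ => RtoC 1)).
{ apply continuous_const. }
apply (@ex_derive_continuous R_AbsRing C_R_NormedModule).
exists (z * psum (fun j => pred (j + 1)) (fun j => INR (j + 1) * p j)%R (RtoC s * z))%C.
apply (is_derive_along_ray (psum (fun j => j + 1)%nat p)) with (K := K); auto.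
- apply (is_series_ge0 _ _) with (2 := HK).
  intros j; specialize (p_ge0 j); assert (H := pow2_ge_0 (INR (j + 1))); nra.
- intros w Hw.
  apply (psum_taylor (fun j => j + 1)%nat); auto. exact ex_p.
Qed.

(** Fundamental theorem of calculus for [alexander (s * z)], whose derivative in the real variable s
    is [z * alexander_deriv (s * z)]. *)
Lemma Cint0_neg_series (z : C) : Cmod z < 1 -> Cint0 (fun t => neg_series t / t)%C z = alexander z.
Proof.
intros Hz; unfold Cint0.
apply (@is_RInt_unique C_R_CompleteNormedModule).
assert (Hs : forall s, 0 <= s <= 1 -> Cmod (RtoC s * z) <= 1).
{ intros s Hs. rewrite Cmod_mult, Cmod_R, Rabs_pos_eq by lra.
  assert (H := Cmod_ge_0 z); nra. }
assert (H01 : alexander z = @minus C_R_NormedModule (alexander (RtoC 1 * z)%C) (alexander (RtoC 0 * z)%C)).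
{ assert (Hq0 : alexander (RtoC 0 * z)%C = RtoC 0).
  { replace (RtoC 0 * z)%C with (RtoC 0) by ring.
    destruct ex_alexander_coef as [l Hl].
    assert (H := Cmod_psum_le (fun j => j + 2)%nat alexander_coef 2 l (RtoC 0)).
    rewrite Cmod_0 in H. unfold alexander.
    rewrite (Cmod_eq_0 (psum _ _ _)); [ring|].
    apply Rle_antisym; [|apply Cmod_ge_0].
    replace 0 with (0 ^ 2 * l) at 2 by ring. apply H; auto; try lra.
    - intros j; lia.
    - intros j; apply alexander_coef_bounds. }
  rewrite Hq0. replace (RtoC 1 * z)%C with z by ring.
  change (alexander z = alexander z - RtoC 0)%C. ring. }
rewrite H01.
(* Equality is required only for 0 < s < 1, so the value of the integrand at s = 0 does not matter;
   for [z = 0] both integrands vanish. *)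
apply (is_RInt_ext (fun s => z * alexander_deriv (RtoC s * z))%C).
- rewrite Rmin_left, Rmax_right by lra; intros s Hs01.
  assert (E := mul_alexander_deriv (RtoC s * z)%C (Hs s ltac:(lra))).
  eq_at C. rewrite <- E.
  destruct (Req_dec (Cmod z) 0) as [Z|Z].
  + rewrite (Cmod_eq_0 _ Z); ring.
  + field; split; [intros Z'; apply Z; rewrite Z'; apply Cmod_0|].
    intros Z'; apply (f_equal fst) in Z'; simpl in Z'; lra.
- apply (@is_RInt_derive C_R_CompleteNormedModule
    (fun s => alexander (RtoC s * z)%C) (fun s => z * alexander_deriv (RtoC s * z))%C).
  + rewrite Rmin_left, Rmax_right by lra; intros s Hs01.
    destruct alexander_taylor as [K [HK H]].
    apply (is_derive_along_ray alexander _ K); auto.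
  + rewrite Rmin_left, Rmax_right by lra; intros s Hs01.
    assert (Hc := continuous_alexander_deriv_ray z s Hz Hs01).
    apply (continuous_comp (U := R_UniformSpace) (V := C_UniformSpace)
      (W := C_UniformSpace) (fun t => alexander_deriv (RtoC t * z)%C) (fun w => z * w)%C); [exact Hc|].
    apply (@continuous_scal_r C_UniformSpace C_AbsRing C_NormedModule z (fun w => w)).
    apply continuous_id.
Qed.

End AlexanderTransform.

Lemma bernoulli_pow_ge (r : R) (n : nat) : 0 <= r <= 1 -> 1 - INR n * (1 - r) <= r ^ n.
Proof.
intros Hr; induction n as [|n IH]; [simpl; lra|].
rewrite S_INR; simpl. assert (H := pow_incr r 1 n Hr). rewrite pow1 in H.
assert (0 <= r ^ n) by (apply pow_le; lra). nra.
Qed.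

(** * The coefficient criterion *)

Section Criterion.

Variable p : nat -> R.
Hypothesis p_ge0 : forall j, 0 <= p j.
Hypothesis ex_p2 : ex_series (fun j => INR (j + 2) ^ 2 * p j).
Variable f : C -> C.
Hypothesis f_alexander : forall z, Cmod z < 1 -> f z = alexander p z.

(** [f] agrees with [alexander p] only inside the disc, so the derivative is transferred by
    agreement on the ball of radius [1 - Cmod z]. *)
Lemma is_derive_f (z : C) : Cmod z < 1 ->
  @is_derive C_AbsRing C_NormedModule f z (alexander_deriv p z).
Proof.
intros Hz.
apply (@is_derive_ext_loc C_AbsRing C_NormedModule (alexander p)).
- apply (locally_le_locally_norm (V := AbsRing_NormedModule C_AbsRing) z).
  assert (Hd : 0 < 1 - Cmod z) by lra.
  exists (mkposreal _ Hd); intros w Hw; change (Cmod (w - z) < 1 - Cmod z) in Hw.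
  symmetry; apply f_alexander.
  replace w with (w - z + z)%C by ring.
  eapply Rle_lt_trans; [apply Cmod_triangle|lra].
- now apply is_derive_alexander.
Qed.

Lemma mul_C_derive_f (z : C) : Cmod z < 1 -> (z * C_derive f z)%C = neg_series p z.
Proof.
intros Hz; rewrite (is_C_derive_unique _ _ _ (is_derive_f z Hz)).
apply mul_alexander_deriv; auto; lra.
Qed.

Lemma class_T_f : class_T f.
Proof.
assert (Hq : forall z, Cmod z < 1 -> is_Cseries
    (fun j => RtoC (alexander_coef p j) * z ^ (j + 2))%C (psum (fun j => j + 2)%nat (alexander_coef p) z)).
{ intros z Hz; apply (psum_correct (fun j => j + 2)%nat (alexander_coef p)); [| |lra].
  - intros j; apply alexander_coef_bounds; auto.
  - now apply ex_alexander_coef. }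
assert (Hj : forall j, (j + 2 - 2 = j)%nat) by (intros; lia).
split; [split|].
- intros z Hz; exists (alexander_deriv p z); now apply is_derive_f.
(* [class_A] adds the series while [class_T] subtracts it, whence witnesses of opposite sign;
   [n - 2] undoes the shift of [tail2]. *)
- exists (fun n => RtoC (- alexander_coef p (n - 2))); intros z Hz.
  exists (- psum (fun j => j + 2)%nat (alexander_coef p) z)%C; split.
  + apply (is_series_ext (fun j => opp (RtoC (alexander_coef p j) * z ^ (j + 2)))%C).
    * intros j; eq_at C; unfold tail2; rewrite Hj, RtoC_opp.
      change (- (RtoC (alexander_coef p j) * z ^ (j + 2)) = - RtoC (alexander_coef p j) * z ^ (j + 2))%C. ring.
    * apply (@is_series_opp C_AbsRing C_NormedModule). now apply Hq.
  + rewrite f_alexander by exact Hz; reflexivity.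
- exists (fun n => RtoC (alexander_coef p (n - 2))); intros z Hz.
  exists (psum (fun j => j + 2)%nat (alexander_coef p) z); split.
  + apply (is_series_ext (fun j => RtoC (alexander_coef p j) * z ^ (j + 2))%C); [|now apply Hq].
    intros j; unfold tail2; rewrite Hj, Cmod_R, Rabs_pos_eq; [reflexivity|].
    apply alexander_coef_bounds; auto.
  + rewrite f_alexander by exact Hz; reflexivity.
Qed.

Lemma S_denom_f (lam : R) (z : C) : Cmod z < 1 ->
  S_denom lam f z = (RtoC (1 - lam) * alexander p z + RtoC lam * neg_series p z)%C.
Proof.
intros Hz; unfold S_denom; now rewrite mul_C_derive_f, f_alexander.
Qed.

Variables sp sq : R.
Hypothesis sum_p : is_series p sp.
Hypothesis sum_alexander_coef : is_series (alexander_coef p) sq.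
Hypothesis sp_le1 : sp <= 1.

Lemma sq_bounds : 0 <= sq <= sp.
Proof.
split.
- apply (is_series_ge0 _ _) with (2 := sum_alexander_coef); intros j; now apply alexander_coef_bounds.
- apply (is_series_le _ _ _ _) with (2 := sum_alexander_coef) (3 := sum_p); intros j; now apply alexander_coef_bounds.
Qed.

(** The hypothesis rearranges to (1 - lam)(sp - sq) <= k (2 - (1 - lam) sq - (1 + lam) sp), the
    desired estimate in the limit r = 1. Multiplying by r^2 and using r^2 < r gives the strict
    inequality inside the disc. *)
Lemma class_S_of_coef_ineq (k lam : R) :
  0 < k -> 0 <= lam < 1 ->
  ((1 - lam) + k * (1 + lam)) * sp + (1 - lam) * (k - 1) * sq <= 2 * k ->
  class_S k lam f.
Proof.
intros Hk Hlam Hc; split; [exact class_T_f|].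
intros z Hz Hz0; unfold unit_disc in Hz.
assert (Hr : 0 < Cmod z) by now apply Cmod_gt_0.
assert (H01 := sq_bounds).
unfold S_quot; rewrite mul_C_derive_f, S_denom_f by exact Hz.
set (P := psum (fun j => j + 2)%nat p z).
set (Q := psum (fun j => j + 2)%nat (alexander_coef p) z).
assert (HP : Cmod P <= Cmod z ^ 2 * sp).
{ apply Cmod_psum_le; auto; [intros; lia|lra]. }
assert (HQ : Cmod Q <= Cmod z ^ 2 * sq).
{ apply Cmod_psum_le; [intros; lia| |auto|lra]. intros; now apply alexander_coef_bounds. }
(* The difference is bounded termwise, using p_n - p_n / n >= 0; bounding P and Q separately would
   give [sp + sq] in place of [sp - sq]. *)
assert (HPQ : Cmod (P - Q) <= Cmod z ^ 2 * (sp - sq)).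
{ apply (@is_series_norm_le C_AbsRing C_NormedModule
    (fun j => RtoC (p j) * z ^ (j + 2) - RtoC (alexander_coef p j) * z ^ (j + 2))%C
    (fun j => Cmod z ^ 2 * (p j - alexander_coef p j))).
  - intros j; change (Cmod (RtoC (p j) * z ^ (j + 2) - RtoC (alexander_coef p j) * z ^ (j + 2))%C
      <= Cmod z ^ 2 * (p j - alexander_coef p j)).
    replace (RtoC (p j) * z ^ (j + 2) - RtoC (alexander_coef p j) * z ^ (j + 2))%C
      with (z ^ 2 * (RtoC (p j - alexander_coef p j) * z ^ j))%C
      by (rewrite Cpow_add_r, RtoC_minus; ring).
    rewrite Cmod_mult, Cmod_pow.
    apply Rmult_le_compat_l; [apply pow2_ge_0|].
    apply Cmod_term_le; [|lra]. assert (H := alexander_coef_bounds p p_ge0 j); lra.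
  - apply (@is_series_minus C_AbsRing C_NormedModule); apply psum_correct; auto; try lra.
    + now exists sp.
    + intros j; now apply alexander_coef_bounds.
    + now exists sq.
  - apply (is_series_scal_l (V := R_NormedModule) (Cmod z ^ 2) (fun j => p j - alexander_coef p j)).
    now apply (@is_series_minus R_AbsRing R_NormedModule). }
change (neg_series p z) with (z - P)%C; change (alexander p z) with (z - Q)%C.
set (r := Cmod z) in *.
set (D := (RtoC (1 - lam) * (z - Q) + RtoC lam * (z - P))%C).
(* D = 0 would make z a convex combination of Q and P, both of modulus at most r^2 < r because
   [sq <= sp <= 1]. *)
assert (HD : D <> RtoC 0).
{ intros E.
  assert (E' : z = (RtoC (1 - lam) * Q + RtoC lam * P)%C).
  { replace z with (D + (RtoC (1 - lam) * Q + RtoC lam * P))%C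
      by (unfold D; rewrite RtoC_minus; ring).
    rewrite E; ring. }
  assert (r <= (1 - lam) * Cmod Q + lam * Cmod P).
  { unfold r at 1; rewrite E'. eapply Rle_trans; [apply Cmod_triangle|].
    rewrite !Cmod_mult, !Cmod_R, !Rabs_pos_eq by lra. lra. }
  assert (Cmod Q <= r ^ 2) by nra. assert (Cmod P <= r ^ 2) by nra.
  nra. }
assert (HS : 2 * r - ((1 - lam) * Cmod Q + (1 + lam) * Cmod P) <= Cmod (z - P + D)%C).
{ assert (2 * r <= Cmod (z - P + D) + Cmod (RtoC (1 - lam) * Q + RtoC (1 + lam) * P)).
  { replace (2 * r) with (Cmod (RtoC 2 * z))
      by (rewrite Cmod_mult, Cmod_R, Rabs_pos_eq by lra; reflexivity).
    replace (RtoC 2 * z)%C with ((z - P + D) + (RtoC (1 - lam) * Q + RtoC (1 + lam) * P))%C.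
    - apply Cmod_triangle.
    - unfold D; rewrite RtoC_minus, RtoC_plus.
      replace (RtoC 2) with (RtoC 1 + RtoC 1)%C by (rewrite <- RtoC_plus; f_equal; ring).
      ring. }
  assert (Cmod (RtoC (1 - lam) * Q + RtoC (1 + lam) * P)
            <= (1 - lam) * Cmod Q + (1 + lam) * Cmod P).
  { eapply Rle_trans; [apply Cmod_triangle|].
    rewrite !Cmod_mult, !Cmod_R, !Rabs_pos_eq by lra. lra. }
  lra. }
assert (HS' : 2 * r - r ^ 2 * ((1 - lam) * sq + (1 + lam) * sp) <= Cmod (z - P + D)%C) by nra.
assert (Hr2 : r ^ 2 < r) by nra.
(* As [sq <= sp <= 1], the lower bound [HS'] is at least 2 (r - r^2) > 0. *)
assert (HS0 : 0 < Cmod (z - P + D)%C).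
{ assert ((1 - lam) * sq + (1 + lam) * sp <= 2) by nra. nra. }
assert (HSne : (z - P + D)%C <> RtoC 0) by now apply Cmod_gt_0.
assert (Ep : ((z - P) / D + 1 = (z - P + D) / D)%C) by (field; exact HD).
split; [exact HD|split].
- rewrite Ep; intros E. apply HSne.
  replace (z - P + D)%C with ((z - P + D) / D * D)%C by (field; exact HD).
  rewrite E; ring.
- replace (((z - P) / D - 1) / ((z - P) / D + 1))%C
    with (- (RtoC (1 - lam) * (P - Q)) / (z - P + D))%C.
  + rewrite Cmod_div, Cmod_opp, Cmod_mult, Cmod_R, Rabs_pos_eq by (exact HSne || lra).
    apply Rmult_lt_reg_r with (1 := HS0); unfold Rdiv.
    rewrite Rmult_assoc, Rinv_l, Rmult_1_r by lra.
    apply Rle_lt_trans with ((1 - lam) * (r ^ 2 * (sp - sq)));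
      [apply Rmult_le_compat_l; lra|].
    apply Rlt_le_trans with (k * (2 * r - r ^ 2 * ((1 - lam) * sq + (1 + lam) * sp)));
      [|apply Rmult_le_compat_l; lra].
    assert (H0 : r ^ 2 * (((1 - lam) + k * (1 + lam)) * sp + (1 - lam) * (k - 1) * sq)
              <= r ^ 2 * (2 * k)) by (apply Rmult_le_compat_l; nra).
    assert (k * (2 * r ^ 2) < k * (2 * r)) by nra.
    lra.
  + replace (- (RtoC (1 - lam) * (P - Q)))%C with (z - P - D)%C
      by (unfold D; rewrite RtoC_minus; ring).
    rewrite Ep. field; split; [exact HD|exact HSne].
Qed.

(** At z = r the condition becomes c P(r) + (1 - lam)(k - 1) Q(r) < 2 k r, with c the coefficient of
    [sp]. As k <= 1, the factor of Q(r) is nonpositive and Q(r) <= sq suffices; only P(r) needs a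
    lower bound, [sp - (1 - r) * L] with [L] the first moment. *)
Lemma coef_ineq_of_class_S (k lam : R) :
  0 < k <= 1 -> 0 <= lam < 1 -> class_S k lam f ->
  ((1 - lam) + k * (1 + lam)) * sp + (1 - lam) * (k - 1) * sq <= 2 * k.
Proof.
intros Hk Hlam [_ HS].
destruct (ex_p1 p p_ge0 ex_p2) as [L HL].
assert (HL0 : 0 <= L).
{ apply (is_series_ge0 _ _) with (2 := HL); intros j.
  apply Rmult_le_pos; [apply pos_INR|auto]. }
assert (H01 := sq_bounds).
assert (Hr : forall r, 0 < r < 1 ->
  ((1 - lam) + k * (1 + lam)) * (sp - (1 - r) * L) + (1 - lam) * (k - 1) * sq < 2 * k).
{ intros r Hr.
  assert (Hrp : forall n, 0 <= r ^ n <= 1).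
  { intros n; split; [apply pow_le; lra|]. rewrite <- (pow1 n); apply pow_incr; lra. }
  assert (Hr2 : forall j, r ^ (j + 2) <= r ^ 2).
  { intros j; rewrite pow_add; specialize (Hrp j); nra. }
  assert (HP : exists P, is_series (fun j => p j * r ^ (j + 2)) P).
  { apply (@ex_series_le R_AbsRing R_CompleteNormedModule _ p); [|now exists sp].
    intros j; change (Rabs (p j * r ^ (j + 2)) <= p j).
    specialize (p_ge0 j); specialize (Hrp (j + 2)%nat).
    rewrite Rabs_pos_eq; nra. }
  assert (HQ : exists Q, is_series (fun j => alexander_coef p j * r ^ (j + 2)) Q).
  { apply (@ex_series_le R_AbsRing R_CompleteNormedModule _ (alexander_coef p)); [|now exists sq].
    intros j; change (Rabs (alexander_coef p j * r ^ (j + 2)) <= alexander_coef p j).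
    destruct (alexander_coef_bounds p p_ge0 j); specialize (Hrp (j + 2)%nat).
    rewrite Rabs_pos_eq; nra. }
  destruct HP as [P HP], HQ as [Q HQ].
  assert (HPr : P <= r ^ 2 * sp).
  { refine (is_series_le _ _ _ _ _ HP
      (is_series_scal_l (V := R_NormedModule) (r ^ 2) p _ sum_p)).
    intros j; change (p j * r ^ (j + 2) <= r ^ 2 * p j).
    specialize (p_ge0 j); specialize (Hr2 j); nra. }
  assert (HQr : Q <= r ^ 2 * sq).
  { refine (is_series_le _ _ _ _ _ HQ
      (is_series_scal_l (V := R_NormedModule) (r ^ 2) (alexander_coef p) _ sum_alexander_coef)).
    intros j; change (alexander_coef p j * r ^ (j + 2) <= r ^ 2 * alexander_coef p j).
    destruct (alexander_coef_bounds p p_ge0 j); specialize (Hr2 j); nra. }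
  assert (HPl : sp - (1 - r) * L <= P).
  { refine (is_series_le _ _ _ _ _
      (is_series_minus (V := R_NormedModule) _ _ _ _ sum_p
        (is_series_scal_l (V := R_NormedModule) (1 - r) _ _ HL)) HP).
    intros j; change (p j - (1 - r) * (INR (j + 2) * p j) <= p j * r ^ (j + 2)).
    specialize (p_ge0 j). assert (H := bernoulli_pow_ge r (j + 2) ltac:(lra)); nra. }
  assert (Hz : Cmod (RtoC r) < 1) by (rewrite Cmod_R, Rabs_pos_eq; lra).
  destruct (HS (RtoC r) Hz) as [HD [HN HC]].
  { intros E; apply (f_equal fst) in E; simpl in E; lra. }
  unfold S_quot in HN, HC; rewrite S_denom_f in HD by exact Hz.
  rewrite S_denom_f, mul_C_derive_f in HN, HC by exact Hz.
  unfold neg_series, alexander in HD, HN, HC.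
  rewrite (psum_RtoC _ _ _ _ HP), (psum_RtoC _ _ _ _ HQ) in HD, HN, HC.
  rewrite <- !RtoC_minus, <- !RtoC_mult, <- RtoC_plus in HD, HN, HC.
  set (D := (1 - lam) * (r - Q) + lam * (r - P)) in *.
  assert (HD' : D <> 0) by (intros E; apply HD; now rewrite E).
  rewrite <- RtoC_div, <- RtoC_plus in HN, HC by exact HD'.
  assert (HN' : (r - P) / D + 1 <> 0) by (intros E; apply HN; now rewrite E).
  rewrite <- RtoC_minus, <- RtoC_div, Cmod_R in HC by exact HN'.
  assert (HE : r - P + D <> 0).
  { intros E; apply HN'. replace ((r - P) / D + 1) with ((r - P + D) / D) by (field; auto).
    rewrite E; unfold Rdiv; ring. }
  (* P and Q are at most r^2 < r, so the real denominator is positive and can be cleared from the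
     inequality. *)
  assert (HE0 : 0 < r - P + D).
  { assert (P <= r) by nra. assert (Q <= r) by nra.
    assert (0 <= D) by (unfold D; nra). lra. }
  replace (((r - P) / D - 1) / ((r - P) / D + 1)) with (- ((1 - lam) * (P - Q) / (r - P + D))) in HC.
  2: { replace ((1 - lam) * (P - Q)) with (- (r - P - D)) by (unfold D; ring).
       field; split; [exact HD'|]; lra. }
  rewrite Rabs_Ropp in HC.
  assert (HC1 := Rle_lt_trans _ _ _ (Rle_abs _) HC).
  apply Rmult_lt_compat_r with (r := r - P + D) in HC1; [|exact HE0].
  unfold Rdiv in HC1; rewrite Rmult_assoc, Rinv_l, Rmult_1_r in HC1 by exact HE.
  replace (r - P + D) with (2 * r - ((1 - lam) * Q + (1 + lam) * P)) in HC1
    by (unfold D; ring).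
  assert (HQs : Q <= sq).
  { specialize (Hrp 2%nat). set (r2 := r ^ 2) in *. nra. }
  assert (((1 - lam) + k * (1 + lam)) * (sp - (1 - r) * L)
    <= ((1 - lam) + k * (1 + lam)) * P) by (apply Rmult_le_compat_l; nra).
  assert ((1 - lam) * (1 - k) * Q <= (1 - lam) * (1 - k) * sq)
    by (apply Rmult_le_compat_l; nra).
  assert (k * (2 * r) < 2 * k) by nra.
  lra. }
set (c := (1 - lam) + k * (1 + lam)) in *.
assert (Hc0 : 0 < c) by (unfold c; nra).
apply Rnot_lt_le; intros Hlt.
(* [d] is the assumed excess over 2 k. For 1 - r = x, [Hr] says d < c x L, whereas x = d / (d + c L
   + 1) gives c x L < d; the [+ 1] ensures x < 1 even when c L = 0. *)
set (d := c * sp + (1 - lam) * (k - 1) * sq - 2 * k).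
assert (Hd : 0 < d) by (unfold d; lra).
assert (HcL : 0 <= c * L) by nra.
assert (Hx : 0 < d / (d + c * L + 1) < 1).
{ split; [apply Rdiv_lt_0_compat; lra|]. apply Rmult_lt_reg_r with (d + c * L + 1); [lra|].
  unfold Rdiv; rewrite Rmult_assoc, Rinv_l by lra; lra. }
set (x := d / (d + c * L + 1)) in *.
assert (Hx1 : x * (d + c * L + 1) = d) by (unfold x; field; lra).
specialize (Hr (1 - x) ltac:(lra)).
replace (1 - (1 - x)) with x in Hr by ring.
assert (c * (x * L) > d) by (unfold d; lra).
nra.
Qed.

End Criterion.

(** * Poisson coefficients *)

Lemma is_series_exp (m : R) : is_series (fun n => m ^ n / INR (fact n)) (exp m).
Proof.
apply (is_series_ext (fun n => scal (pow_n m n) (/ INR (fact n)))); [|apply is_exp_Reals].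
intros n; rewrite pow_n_pow; reflexivity.
Qed.

Definition pois (m : R) (j : nat) : R := poisson_coef m (j + 2).

Lemma pois_eq (m : R) (j : nat) :
  pois m j = m ^ (S j) / INR (fact (S j)) * exp (- m).
Proof. unfold pois, poisson_coef; now replace (j + 2 - 1)%nat with (S j) by lia. Qed.

Lemma pois_ge0 (m : R) (j : nat) : 0 < m -> 0 <= pois m j.
Proof.
intros Hm; rewrite pois_eq; apply Rmult_le_pos; [|left; apply exp_pos].
left; apply Rdiv_lt_0_compat; [now apply pow_lt|apply INR_fact_lt_0].
Qed.

(** This is e^(-m) times the exponential series without its term of index 0. *)
Lemma sum_pois (m : R) : is_series (pois m) (1 - exp (- m)).
Proof.
apply (is_series_ext (fun j => m ^ S j / INR (fact (S j)) * exp (- m))).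
{ intros j; now rewrite pois_eq. }
replace (1 - exp (- m)) with ((exp m - 1) * exp (- m))
  by (rewrite Rmult_minus_distr_r, <- exp_plus, Rplus_opp_r, exp_0; ring).
apply is_series_scal_r.
apply (is_series_incr_1 (V := R_NormedModule) (fun n => m ^ n / INR (fact n))).
replace (plus _ _) with (exp m); [apply is_series_exp|].
change (exp m = exp m - 1 + 1 / 1); field.
Qed.

(** Dividing by n completes the factorial: p_n / n = (m^n / n!) (e^(-m) / m), so the sum is a tail
    of the exponential series from index 2. *)
Lemma sum_alexander_coef_pois (m : R) : 0 < m ->
  is_series (alexander_coef (pois m)) ((1 - exp (- m) - m * exp (- m)) / m).
Proof.
intros Hm.
apply (is_series_ext (fun j => m ^ (2 + j) / INR (fact (2 + j)) * (exp (- m) / m))).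
{ intros j; unfold alexander_coef; rewrite pois_eq.
  replace (j + 2)%nat with (S (S j)) by lia; change (2 + j)%nat with (S (S j)).
  rewrite (fact_simpl (S j)), mult_INR.
  simpl (m ^ _); eq_at R; field.
  split; [apply INR_fact_neq_0|split; [|lra]]; apply not_0_INR; lia. }
replace ((1 - exp (- m) - m * exp (- m)) / m) with ((exp m - 1 - m) * (exp (- m) / m)).
2: { assert (E : exp m * exp (- m) = 1) by (rewrite <- exp_plus, Rplus_opp_r; apply exp_0).
     rewrite <- E at 2; field; lra. }
apply is_series_scal_r.
apply (is_series_incr_n (V := R_NormedModule) (fun n => m ^ n / INR (fact n)) 2); [lia|].
replace (plus _ _) with (exp m); [apply is_series_exp|].
simpl pred; rewrite sum_Sn, sum_O.
change (exp m = exp m - 1 - m + (1 / 1 + m * 1 / 1)); field.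
Qed.

(** Since (j + 2)^2 <= 4 * 4^(j + 1), the second moment is dominated by a multiple of the
    exponential series at 4 m. *)
Lemma ex_pois2 (m : R) : 0 < m -> ex_series (fun j => INR (j + 2) ^ 2 * pois m j).
Proof.
intros Hm.
apply (@ex_series_le R_AbsRing R_CompleteNormedModule _
  (fun j => (4 * m) ^ S j / INR (fact (S j)) * (4 * exp (- m)))).
- intros j; change (Rabs (INR (j + 2) ^ 2 * pois m j)
    <= (4 * m) ^ S j / INR (fact (S j)) * (4 * exp (- m))).
  assert (H0 := pois_ge0 m j Hm).
  rewrite Rabs_pos_eq by (apply Rmult_le_pos; [apply pow2_ge_0|exact H0]).
  replace ((4 * m) ^ S j / INR (fact (S j)) * (4 * exp (- m)))
    with (4 * 4 ^ S j * pois m j)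
    by (rewrite pois_eq, Rpow_mult_distr; field; apply INR_fact_neq_0).
  apply Rmult_le_compat_r; [exact H0|]. clear H0.
  induction j as [|j IH]; [simpl; lra|].
  change (S j + 2)%nat with (S (j + 2)); rewrite S_INR.
  change (4 ^ S (S j)) with (4 * 4 ^ S j).
  assert (H := INR_add2_ge j). nra.
- apply ex_series_scal_r.
  apply (ex_series_incr_1 (V := R_NormedModule) (fun n => (4 * m) ^ n / INR (fact n))).
  exists (exp (4 * m)); apply is_series_exp.
Qed.

(** * The criterion applied to the Poisson coefficients *)

Theorem theorem4p2 :
  forall m k lam : R,
    0 < m -> 0 < k <= 1 -> 0 <= lam < 1 ->
    (class_S k lam (poisson_G m) <->
     ((1 - lam) + k * (1 + lam)) * (1 - exp (- m))
       + (1 - lam) * (k - 1) / m * (1 - exp (- m) - m * exp (- m))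
     <= 2 * k).
Proof.
intros m k lam Hm Hk Hlam.
assert (H0 : forall j, 0 <= pois m j) by (intros j; now apply pois_ge0).
(* [poisson_F m] is convertible with [neg_series (pois m)], so the general integral formula applies
   directly. *)
assert (HG : forall z, Cmod z < 1 -> poisson_G m z = alexander (pois m) z).
{ intros z Hz; now apply (Cint0_neg_series (pois m) H0 (ex_pois2 m Hm)). }
replace ((1 - lam) * (k - 1) / m * (1 - exp (- m) - m * exp (- m)))
  with ((1 - lam) * (k - 1) * ((1 - exp (- m) - m * exp (- m)) / m)) by (field; lra).
assert (Hsp : 1 - exp (- m) <= 1) by (assert (H := exp_pos (- m)); lra).
assert (H2 := ex_pois2 m Hm). assert (Sp := sum_pois m). assert (Sq := sum_alexander_coef_pois m Hm).
split.
- now apply (coef_ineq_of_class_S (pois m)).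
- now apply (class_S_of_coef_ineq (pois m)).
Qed.
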